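(* Let $A$ be a finite alphabet, let $U$ be a universal code over $A$, and for every finite word $u$ over $A$ put $$\mu_U(u) = \frac{2^{-|U(u)|}}{\sum_{v\in A^{|u|}} 2^{-|U(v)|}} .$$ Then for every stationary and ergodic source $P$ over $A$: i) with $P$-probability 1, $$\lim_{t\to\infty}\frac1t\Bigl(-\log P(x_1\cdots x_t)-\bigl(-\log\mu_U(x_1\cdots x_t)\bigr)\Bigr)=0;$$ ii) $$\lim_{t\to\infty}\frac1t\sum_{u\in A^t}P(u)\log\bigl(P(u)/\mu_U(u)\bigr)=0 .$$
   Context: $\log=\log_2$ and $0\log 0=0$. $A^t$ is the set of words of length $t$ over $A$; $|u|$ is the length of a word $u$. A source $P$ is a probability measure on $A^\infty$; $P(x_1\cdots x_t)$ is the probability that the first $t$ letters are $x_1\cdots x_t$. It is stationary if invariant under the shift $T(x_1,x_2,\dots)=(x_2,x_3,\dots)$, and ergodic if every shift-invariant set has probability 0 or 1. A code $\varphi$ over $A$ is a family of maps $\varphi_n:A^n\to\{0,1\}^*$, $n=1,2,\dots$ (one writes $\varphi(u)=\varphi_n(u)$ for $u\in A^n$), such that for each $n$ the map $\varphi_n$ is injective and every concatenation $\varphi_n(u_1)\cdots\varphi_n(u_r)$, $r\ge1$, $u_i\in A^n$, can be uniquely decoded into $u_1\cdots u_r$. $|\varphi(u)|$ is the length of the codeword. Shannon entropy of a stationary ergodic $P$: $h_m(P)=-\sum_{v\in A^m}P(v)\sum_{a\in A}P(a|v)\log P(a|v)$ and $h_\infty(P)=\lim_{m\to\infty}h_m(P)$.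 A code $U$ is universal if for every stationary and ergodic source $P$ over $A$: $\lim_{t\to\infty}|U(x_1\cdots x_t)|/t=h_\infty(P)$ with $P$-probability 1, and $\lim_{t\to\infty}E(|U(x_1\cdots x_t)|)/t=h_\infty(P)$. *)

(* Defs.v *)
From HB Require Import structures.
From mathcomp Require Import all_boot all_order all_algebra.
From mathcomp Require Import all_classical all_reals all_analysis.

Set Implicit Arguments.
Unset Strict Implicit.
Unset Printing Implicit Defensive.

Import Order.TTheory GRing.Theory Num.Theory.
Import numFieldNormedType.Exports.

Local Open Scope classical_set_scope.
Local Open Scope ring_scope.

(* The letter a0 only witnesses that the alphabet is nonempty (measurable types
   of the library are pointed, and an empty alphabet carries no source); the
   sigma-algebra below does not depend on it.  Letters are numbered from 0:
   the first letter of x is x 0. *)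
Definition sequences (A : finType) (a0 : A) : Type := nat -> A.

HB.instance Definition _ (A : finType) (a0 : A) :=
  Choice.copy (sequences a0) (nat -> A).
HB.instance Definition _ (A : finType) (a0 : A) :=
  isPointed.Build (sequences a0) (fun _ => a0).

Definition first_letters (A : Type) (t : nat) (x : nat -> A) : t.-tuple A :=
  [tuple x i | i < t].

Definition cylinder (A : Type) (t : nat) (u : t.-tuple A) : set (nat -> A) :=
  [set x | first_letters t x = u].

Definition cylinders (A : finType) (a0 : A) : set (set (sequences a0)) :=
  [set E | exists (t : nat) (u : t.-tuple A), E = cylinder u].
Arguments cylinders {A} a0.

Notation seq_space a0 := (g_sigma_algebraType (cylinders a0)).

Definition shift (A : Type) (x : nat -> A) : nat -> A := fun n => x n.+1.

Definition stationary (R : realType) (A : finType) (a0 : A)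
    (P : probability (seq_space a0) R) : Prop :=
  forall E : set (seq_space a0), measurable E -> P (@shift A @^-1` E) = P E.

Definition ergodic (R : realType) (A : finType) (a0 : A)
    (P : probability (seq_space a0) R) : Prop :=
  forall E : set (seq_space a0), measurable E -> @shift A @^-1` E = E ->
    P E = 0%E \/ P E = 1%E.

Definition word_prob (R : realType) (A : finType) (a0 : A)
    (P : probability (seq_space a0) R) (t : nat) (u : t.-tuple A) : R :=
  fine (P (cylinder u)).

(* ln vanishes on nonpositive reals, so x * log2 x is 0 at x = 0. *)
Definition log2 (R : realType) (x : R) : R := ln x / ln 2.

(* P(a|v); it is 0 when P(v) = 0. *)
Definition cond_prob (R : realType) (A : finType) (a0 : A)
    (P : probability (seq_space a0) R) (m : nat) (v : m.-tuple A) (a : A) : R :=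
  word_prob P [tuple of rcons v a] / word_prob P v.

Definition entropy (R : realType) (A : finType) (a0 : A)
    (P : probability (seq_space a0) R) (m : nat) : R :=
  - \sum_(v : m.-tuple A) word_prob P v *
      \sum_(a : A) cond_prob P v a * log2 (cond_prob P v a).

Definition entropy_rate (R : realType) (A : finType) (a0 : A)
    (P : probability (seq_space a0) R) : R :=
  lim (entropy P m @[m --> \oo]).

(* The value at n = 0 is irrelevant: a code only encodes nonempty words. *)
Definition code_maps (A : finType) := forall n : nat, n.-tuple A -> seq bool.

(* Unique decoding: two (nonempty) concatenations of codewords of blocks of
   length n, with possibly different numbers of blocks, coincide only if the
   blocks are the same. *)
Definition is_code (A : finType) (phi : code_maps A) : Prop :=
  forall n : nat, (0 < n)%N ->
    injective (@phi n) /\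
    (forall us vs : seq (n.-tuple A), us <> [::] -> vs <> [::] ->
       flatten (map (@phi n) us) = flatten (map (@phi n) vs) -> us = vs).

Definition universal_code (R : realType) (A : finType) (a0 : A)
    (U : code_maps A) : Prop :=
  is_code U /\
  forall P : probability (seq_space a0) R, stationary P -> ergodic P ->
    {ae P, forall x : seq_space a0,
      ((size (U t (first_letters t x)))%:R / t%:R : R) @[t --> \oo]
        --> entropy_rate P} /\
    ((t%:R^-1)%:E *
       'E_P[fun x : seq_space a0 => (size (U t (first_letters t x)))%:R])%E
      @[t --> \oo] --> (entropy_rate P)%:E.

Definition mu (R : realType) (A : finType) (U : code_maps A)
    (t : nat) (u : t.-tuple A) : R :=
  2 ^- size (U t u) / \sum_(v : t.-tuple A) 2 ^- size (U t v).

(* Main.v *)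
Require Import Defs.
From HB Require Import structures.
From mathcomp Require Import all_boot all_order all_algebra.
From mathcomp Require Import all_classical all_reals all_analysis.
From mathcomp Require Import ring lra zify.

Import Order.TTheory GRing.Theory Num.Theory.
Import numFieldNormedType.Exports.

Local Open Scope classical_set_scope.
Local Open Scope ring_scope.

(* Universality gives |U|/t -> h almost surely and in mean, so the theorem
   amounts to -log P(x_1..x_t)/t -> h together with log Z_t/t -> 0, where
   Z_t = sum_v 2^-|U(v)|.

   Z_t <= 1 by Kraft-McMillan, while Gibbs' inequality gives
   log Z_t >= H(X_1..X_t) - E|U| >= t h - E|U|; this settles Z_t and part (ii).

   Upper bound for -log P: by Kraft, P{P(u) 2^(eps t) < 2^-|U(u)|} <= 2^(-eps t),
   and Borel-Cantelli applies.

   Lower bound: if c < h and P(x_1..x_n) >= 2^(-cn) infinitely often with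
   positive probability, then with probability 1 by ergodicity. Cutting long
   words greedily into such heavy blocks of bounded length, plus a few
   isolated letters, and weighting every parsing by the product of the weights
   of its pieces yields a measure on words of length N of total mass at most
   2^(eps N) which typically exceeds 2^(-(c+eps)N). Gibbs' inequality then
   gives h <= c. *)

(** * Gibbs' inequality *)

Lemma ln_ratio_le (R : realType) (p q : R) :
  0 <= p -> 0 <= q -> (0 < p -> 0 < q) -> p * ln q - p * ln p <= q - p.
Proof.
move=> p0 q0 pq; have [p_gt0|] := ltP 0 p; last first.
  move=> p_le0; have -> : p = 0 by apply: le_anti; rewrite p0 p_le0.
  by rewrite !mul0r !subr0.
have q_gt0 := pq p_gt0.
have qp0 : 0 < q / p by rewrite divr_gt0.
(* The tangent bound ln (1 + y) <= y at y = q / p - 1, then multiplied by p. *)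
have := @le_ln1Dx R (q / p - 1); rewrite addrCA subrr addr0.
rewrite ltrBrDl subrr => /(_ qp0); rewrite ln_div ?posrE// => h.
rewrite -mulrBr (le_trans (ler_wpM2l p0 h))//.
by rewrite mulrBr mulr1 mulrCA divff ?gt_eqF// mulr1.
Qed.

(** Summing the pointwise bound leaves only the difference of the total masses, so q may be a
    subprobability. Positivity of q on the support of p guards against the default value ln 0 =
    0. *)
Lemma gibbs (R : realType) (T : finType) (p q : T -> R) :
  (forall x, 0 <= p x) -> (forall x, 0 <= q x) ->
  (forall x, 0 < p x -> 0 < q x) -> \sum_x q x <= \sum_x p x ->
  \sum_x p x * ln (q x) <= \sum_x p x * ln (p x).
Proof.
move=> p0 q0 pq qp; rewrite -subr_le0 -sumrB.
apply: (@le_trans _ _ (\sum_x (q x - p x))).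
  by apply: ler_sum => x _; apply: ln_ratio_le; auto.
by rewrite sumrB subr_le0.
Qed.

(** Gibbs' inequality for q divided by its total mass. It serves the code weights 2^-|U(u)| and the
    parsing weights, whose masses are estimated separately. *)
Lemma gibbs_unnormalized (R : realType) (T : finType) (p q : T -> R) :
  (forall x, 0 <= p x) -> (forall x, 0 < q x) -> \sum_x p x = 1 ->
  \sum_x p x * ln (q x) - ln (\sum_x q x) <= \sum_x p x * ln (p x).
Proof.
move=> p0 q0 p1; set Q := \sum_x q x.
have Q0 : 0 < Q.
  (* Total mass 1 of p forces T to be inhabited, hence Q > 0. *)
  have [x _|T0] := pickP (fun _ : T => true).
    by rewrite /Q (bigD1 x)//= ltr_pwDl// sumr_ge0// => y _; rewrite ltW.
  by move: p1; rewrite big_pred0// => /eqP; rewrite eq_sym oner_eq0.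
apply: (@le_trans _ _ (\sum_x p x * ln (q x / Q))); last first.
  apply: gibbs => // [x|x _|]; first by rewrite divr_ge0// ltW.
    by rewrite divr_gt0.
  by rewrite -mulr_suml divff ?gt_eqF// p1.
rewrite -[X in _ - X]mul1r -p1 mulr_suml -sumrB.
by apply: ler_sum => x _; rewrite ln_div ?posrE// mulrBr.
Qed.

(** * Sums over words of fixed length *)

Section WordSums.
Context {R : pzSemiRingType} {A : finType}.
Implicit Types F G : seq A -> R.

Lemma sum_word0 F : \sum_(u : 0.-tuple A) F u = F [::].
Proof.
rewrite (bigD1 [tuple])//= big1 ?addr0// => u.
by move=> /eqP[]; exact: tuple0.
Qed.

Lemma sum_word_cons n F :
  \sum_(u : n.+1.-tuple A) F u = \sum_a \sum_(u : n.-tuple A) F (a :: u).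
Proof.
rewrite pair_big /=.
rewrite (reindex (fun p : A * n.-tuple A => [tuple of p.1 :: p.2]))//=.
exists (fun u => (thead u, [tuple of behead u])) => [[a u] _|u _]/=.
  by congr pair; apply: val_inj.
by rewrite -tuple_eta.
Qed.

Lemma sum_word_rcons n F :
  \sum_(u : n.+1.-tuple A) F u = \sum_(u : n.-tuple A) \sum_a F (rcons u a).
Proof.
elim: n F => [|n IH] F.
  rewrite sum_word_cons (sum_word0 (fun u => \sum_a F (rcons u a))).
  by apply: eq_bigr => a _; rewrite (sum_word0 (fun u => F (a :: u))).
rewrite sum_word_cons (sum_word_cons _ (fun u => \sum_a F (rcons u a))).
by apply: eq_bigr => a _; rewrite (IH (fun u => F (a :: u))).
Qed.

Lemma sum_word_cat n m F G :
  \sum_(u : (n + m).-tuple A) F (take n u) * G (drop n u) =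
  (\sum_(u : n.-tuple A) F u) * (\sum_(u : m.-tuple A) G u).
Proof.
elim: n F => [|n IH] F.
  rewrite sum_word0 big_distrr /=.
  by apply: eq_bigr => u _; rewrite take0 drop0.
rewrite [(n.+1 + m)%N]addSn.
rewrite (sum_word_cons _ (fun u => F (take n.+1 u) * G (drop n.+1 u))).
rewrite sum_word_cons big_distrl /=.
by apply: eq_bigr => a _; rewrite -(IH (fun u => F (a :: u))).
Qed.

End WordSums.

Lemma sum_tuple_prod (R : comPzSemiRingType) (T : finType) (F : T -> R) k :
  \sum_(us : k.-tuple T) \prod_(u <- us) F u = (\sum_u F u) ^+ k.
Proof.
elim: k => [|k IH].
  by rewrite (sum_word0 (fun us => \prod_(u <- us) F u)) big_nil expr0.
rewrite (sum_word_cons _ (fun us => \prod_(u <- us) F u)) exprS big_distrl /=.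
apply: eq_bigr => a _; rewrite -IH big_distrr /=.
by apply: eq_bigr => us _; rewrite big_cons.
Qed.

(** * The Kraft-McMillan inequality *)

Lemma le1_of_linear_powers (R : realType) (z C : R) :
  (forall k : nat, z ^+ k <= k%:R * C + 1) -> z <= 1.
Proof.
move=> h; rewrite leNgt; apply/negP => z1.
have bern k : 1 + k%:R * (z - 1) <= z ^+ k.
  elim: k => [|k IH]; first by rewrite mul0r addr0 expr0.
  rewrite exprS -natr1; apply: le_trans (ler_wpM2l (ltW (lt_trans ltr01 z1)) IH).
  rewrite -subr_ge0 [X in 0 <= X](_ : _ = k%:R * (z - 1) ^+ 2); last by ring.
  by rewrite mulr_ge0// sqr_ge0.
pose d := z - 1; have d0 : 0 < d by rewrite subr_gt0.
have C0 : 0 < C by have := h 1%N; rewrite expr1; lra.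
(* Bernoulli alone is linear in k. Its square, at exponent 2k, contains (kd)^2, which exceeds 2kC
   for this k and contradicts the hypothesis. *)
have [k /= kd] : exists k : nat, 2 * C < k%:R * d ^+ 2.
  exists (Num.truncn (2 * C / d ^+ 2)).+1.
  by rewrite -ltr_pdivrMr ?exprn_gt0//; exact: truncnS_gt.
have k0 : 0 < k%:R :> R.
  have : 0 < k%:R * d ^+ 2 by lra.
  by rewrite pmulr_lgt0// exprn_gt0.
pose y := k%:R * d; have y0 : 0 < y by rewrite mulr_gt0.
have C_lt : 2 * C < y * d by rewrite /y -mulrA -expr2.
have := h (k * 2)%N; rewrite exprM natrM => h2.
have := bern k; rewrite -/d => bk.
have : (1 + y) ^+ 2 <= (z ^+ k) ^+ 2.
  by rewrite ler_sqr// nnegrE; [lra|exact: exprn_ge0 (ltW (lt_trans ltr01 z1))].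
have : k%:R * (2 * C) < y * y.
  have -> : y * y = k%:R * (y * d) by rewrite /y; ring.
  by rewrite ltr_pM2l.
nra.
Qed.

(** There are at most 2^l codewords of length l, so each of the B + 1 possible lengths contributes
    at most 1. *)
Lemma kraft_inj (R : realType) (T : finType) (c : T -> seq bool) (B : nat) :
  injective c -> (forall t, (size (c t) <= B)%N) ->
  \sum_t 2 ^- size (c t) <= B.+1%:R :> R.
Proof.
move=> cinj cB.
rewrite (partition_big (fun t => inord (size (c t)) : 'I_B.+1) xpredT)//=.
rewrite -[X in _ <= X%:R]card_ord -sum1_card natr_sum ler_sum// => l _.
have sz t : (inord (size (c t)) == l :> 'I_B.+1) -> size (c t) = l.
  by move=> /eqP <-; rewrite inordK// ltnS.
rewrite (eq_bigr (fun=> 2 ^- l)); last by move=> t /sz ->.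
rewrite sumr_const -[_ *+ _]mulr_natr mulrC.
rewrite ler_pdivrMr ?exprn_gt0// mul1r -natrX ler_nat.
have <- : #|{: l.-tuple bool}| = (2 ^ l)%N by rewrite card_tuple card_bool.
(* On the fibre considered all codewords have length l, so the default tuple is never taken and f
   inherits injectivity from c. *)
pose f t : l.-tuple bool := insubd [tuple of nseq l true] (c t).
rewrite -(card_in_imset (f := f)) ?max_card// => s t /sz ss /sz st.
by move=> /(congr1 val); rewrite !val_insubd /= ss st !eqxx; exact: cinj.
Qed.

(** McMillan's power trick: the k-th power of the sum is the Kraft sum of the concatenations of k
    codewords. Unique decoding makes these distinct and their lengths are at most kL, so the power
    grows at most linearly in k. *)
Lemma kraft_mcmillan (R : realType) (A : finType) (U : code_maps A) (n : nat) :
  is_code U -> (0 < n)%N -> \sum_(u : n.-tuple A) 2 ^- size (U n u) <= 1 :> R.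
Proof.
move=> cU n0; have [_ dec] := cU n n0.
pose L := (\max_(u : n.-tuple A) size (U n u))%N.
(* The power 0 is treated apart, since unique decoding concerns nonempty concatenations. *)
apply: (@le1_of_linear_powers _ _ L%:R) => -[|k]; first by rewrite mul0r add0r.
rewrite -sum_tuple_prod -natrM natr1.
pose c (us : k.+1.-tuple (n.-tuple A)) := flatten (map (U n) us).
under eq_bigr => us _.
  have -> : \prod_(u <- us) 2 ^- size (U n u) = 2 ^- size (c us) :> R.
    rewrite /c; elim: (tval us) => [|u s IH]; first by rewrite big_nil invr1.
    by rewrite big_cons IH /= size_cat exprD invfM.
  over.
apply: kraft_inj => [us vs|us].
  move=> cE; apply: val_inj; apply: dec => //.
    by case: us {cE} => -[].
  by case: vs {cE} => -[].
rewrite /c -[X in (_ <= X * _)%N](size_tuple us); elim: (tval us) => //= u s IH.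
by rewrite size_cat mulSn leq_add// /L (leq_bigmax u).
Qed.

(** * Word probabilities and events on finitely many letters *)

Section WordProbability.
Context {R : realType} {A : finType} {a0 : A} (P : probability (seq_space a0) R).
Implicit Types (s : seq A).

(** Indexing by sequences instead of tuples lets words of different lengths share one function,
    without casts under [take], [drop] or [rcons]. *)
Definition seq_prob s : R := word_prob P (in_tuple s).

Lemma first_letters_mkseq t (x : nat -> A) : first_letters t x = mkseq x t :> seq A.
Proof.
by rewrite /mkseq -val_enum_ord -map_comp.
Qed.

Lemma take_mkseq (x : nat -> A) (n m : nat) :
  (n <= m)%N -> take n (mkseq x m) = mkseq x n.
Proof. by move=> nm; rewrite /mkseq -map_take take_iota (minn_idPl nm). Qed.


Lemma mkseq_shift (x : nat -> A) n : mkseq x n.+1 = x 0%N :: mkseq (Defs.shift x) n.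
Proof. by rewrite /mkseq /= (iotaDl 1 0) -map_comp. Qed.

Lemma cylinderE t (u : t.-tuple A) : cylinder u = [set x | mkseq x t = u].
Proof.
apply/seteqP; split => x; rewrite /cylinder/=.
  by move=> <-; rewrite first_letters_mkseq.
by move=> xu; apply: val_inj; rewrite [LHS]first_letters_mkseq.
Qed.

Lemma word_probE t (u : t.-tuple A) : word_prob P u = seq_prob u.
Proof. by rewrite /seq_prob /word_prob !cylinderE /= size_tuple. Qed.

Lemma measurable_cylinder t (u : t.-tuple A) :
  measurable (cylinder u : set (seq_space a0)).
Proof. by apply: sub_gen_smallest; exists t, u. Qed.

Lemma seq_prob_ge0 s : 0 <= seq_prob s.
Proof. exact: fine_ge0. Qed.

Lemma EFin_seq_prob t (u : t.-tuple A) : (seq_prob u)%:E = P (cylinder u).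
Proof.
by rewrite -word_probE fineK// fin_num_measure//; exact: measurable_cylinder.
Qed.

Lemma measurable_first_letters t (Q : set (t.-tuple A)) :
  measurable ([set x | Q (first_letters t x)] : set (seq_space a0)).
Proof.
rewrite (_ : [set _ | _] = \bigcup_(u in Q) cylinder u).
  by apply: fin_bigcup_measurable => // u _; exact: measurable_cylinder.
apply/seteqP; split => x /=; first by move=> Qx; exists (first_letters t x).
by move=> [u Qu]; rewrite /cylinder/= => ->.
Qed.

(** The integrand is a finite combination of indicators of cylinders, so expectations of functions
    of a prefix become finite sums. *)
Lemma integral_first_letters t (f : t.-tuple A -> R) :
  (\int[P]_x (f (first_letters t x))%:E)%E =
  (\sum_(u : t.-tuple A) seq_prob u * f u)%:E.
Proof.
transitivity (\int[P]_x
  (\sum_(u : t.-tuple A) (f u)%:E * (\1_(cylinder u) x)%:E))%E.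
  apply: eq_integral => x _.
  rewrite (bigD1 (first_letters t x))//= big1 ?adde0.
    by rewrite indicE mem_set ?mule1.
  move=> u ux; rewrite indicE memNset ?mule0//= => xu.
  by move: ux; rewrite xu eqxx.
have mcyl (u : t.-tuple A) := @measurable_cylinder t u.
rewrite integral_sum//; last first.
  by move=> u; apply: integrableZl => //; exact: integrable_indic.
rewrite -sumEFin; apply: eq_bigr => u _.
rewrite integralZl//; last exact: integrable_indic.
by rewrite integral_indic// setIT EFinM EFin_seq_prob muleC.
Qed.

Lemma prob_first_letters t (Q : pred (t.-tuple A)) :
  P [set x | Q (first_letters t x)] =
  (\sum_(u : t.-tuple A | Q u) seq_prob u)%:E.
Proof.
have mQ := @measurable_first_letters t (fun u => Q u).
rewrite -[LHS](_ : (\int[P]_x ((Q (first_letters t x))%:R)%:E)%E = _).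
  rewrite (integral_first_letters _ (fun u => (Q u)%:R)) [in RHS]big_mkcond.
  by congr EFin; apply: eq_bigr => u _; case: ifP => _; rewrite ?mulr1 ?mulr0.
rewrite -[in RHS](setIT [set _ | _]) -integral_indic//.
apply: eq_integral => x _; rewrite indicE.
by case: (boolP (Q _)) => q; [rewrite mem_set|rewrite memNset//; apply/negP].
Qed.

Lemma sum_seq_prob t : \sum_(u : t.-tuple A) seq_prob u = 1.
Proof.
apply: EFin_inj; rewrite -[LHS](prob_first_letters t xpredT).
by rewrite -(@probability_setT _ _ _ P); congr (P _); apply/seteqP.
Qed.

Lemma seq_prob_nil : seq_prob [::] = 1.
Proof. by rewrite -(sum_seq_prob 0) (sum_word0 seq_prob). Qed.

Lemma sum_seq_prob_rcons s : \sum_a seq_prob (rcons s a) = seq_prob s.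
Proof.
apply: EFin_inj; rewrite (EFin_seq_prob _ (in_tuple s)).
rewrite [X in P X](_ : _ =
    [set x | (take (size s) (first_letters (size s).+1 x)) == s]).
  rewrite (prob_first_letters _ (fun u => take (size s) u == s)).
  rewrite [in RHS]big_mkcond (sum_word_rcons _ (fun u =>
    if take (size s) u == s then seq_prob u else 0)).
  rewrite (bigD1 (in_tuple s))//= [X in _ + X]big1 ?addr0 => [|u us].
    by congr EFin; apply: eq_bigr => a _; rewrite -cats1 take_size_cat// eqxx.
  rewrite big1// => a _; rewrite -cats1 take_size_cat ?size_tuple//.
  by rewrite ifN.
rewrite cylinderE; apply/seteqP; split => x /=.
  by move=> <-; rewrite first_letters_mkseq size_mkseq take_mkseq.
by move=> /eqP; rewrite first_letters_mkseq take_mkseq.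
Qed.

Hypothesis P_stationary : stationary P.

(** Unlike summation over the last letter, this uses stationarity: the shift preimage of the
    cylinder of s leaves the first letter free. *)
Lemma sum_seq_prob_cons s : \sum_a seq_prob (a :: s) = seq_prob s.
Proof.
apply: EFin_inj; rewrite (EFin_seq_prob _ (in_tuple s)).
rewrite -P_stationary; last exact: measurable_cylinder.
rewrite [X in P X](_ : _ =
    [set x | (behead (first_letters (size s).+1 x)) == s]).
  rewrite (prob_first_letters _ (fun u => behead u == s)).
  rewrite [in RHS]big_mkcond (sum_word_cons _ (fun u =>
    if behead u == s then seq_prob u else 0)).
  congr EFin; apply: eq_bigr => a _.
  rewrite (bigD1 (in_tuple s))//= eqxx [X in _ + X]big1 ?addr0 => [//|u us].
  by rewrite ifN.
rewrite cylinderE; apply/seteqP; split => x /=; rewrite first_letters_mkseq mkseq_shift.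
  by move=> ->.
by move=> /eqP.
Qed.

Lemma seq_prob_cons_le a s : seq_prob (a :: s) <= seq_prob s.
Proof.
rewrite -[leRHS]sum_seq_prob_cons (bigD1 a)//= lerDl sumr_ge0// => b _.
exact: seq_prob_ge0.
Qed.

End WordProbability.

(** * Block entropies and the entropy rate *)

Section Entropy.
Context {R : realType} {A : finType} {a0 : A} (P : probability (seq_space a0) R).
Hypothesis P_stationary : stationary P.
Local Notation p := (seq_prob P).

(** Joint entropy of the first t letters in nats; dividing by ln 2 gives bits. *)
Definition word_entropy t : R := - \sum_(u : t.-tuple A) p u * ln (p u).

Lemma word_entropy0 : word_entropy 0 = 0.
Proof.
rewrite /word_entropy (sum_word0 (fun u => p u * ln (p u))).
by rewrite seq_prob_nil ln1 mulr0 oppr0.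
Qed.

Lemma seq_prob_rcons_le s a : p (rcons s a) <= p s.
Proof.
rewrite -(sum_seq_prob_rcons P s) (bigD1 a)//= lerDl sumr_ge0// => b _.
exact: seq_prob_ge0.
Qed.

(** The chain rule for entropy. *)
Lemma entropyE m :
  entropy P m = (word_entropy m.+1 - word_entropy m) / ln 2.
Proof.
rewrite /entropy /word_entropy (sum_word_rcons _ (fun u => p u * ln (p u))).
rewrite opprK addrC -opprB mulNr; congr (- _); rewrite -sumrB big_distrl /=.
apply: eq_bigr => v _; rewrite /cond_prob !word_probE.
under eq_bigr do rewrite word_probE /=.
(* All extensions of a null word are null, so it contributes 0 to both sides. *)
have [pv0|pv0] := eqVneq (p v) 0.
  rewrite pv0 !mul0r subr0 big1 ?mul0r// => a _.
  have -> : p (rcons v a) = 0.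
    by apply: le_anti; rewrite seq_prob_ge0 -pv0 seq_prob_rcons_le.
  by rewrite mul0r.
have pv_gt0 : 0 < p v by rewrite lt_neqAle eq_sym pv0 seq_prob_ge0.
rewrite -{4}(sum_seq_prob_rcons P v) [X in _ - X]big_distrl /= -sumrB.
rewrite big_distrl big_distrr /=; apply: eq_bigr => a _.
have [->|pva] := eqVneq (p (rcons v a)) 0; first by rewrite !mul0r mulr0 subr0 mul0r.
have pva_gt0 : 0 < p (rcons v a) by rewrite lt_neqAle eq_sym pva seq_prob_ge0.
by rewrite mulrA [p v * _]mulrCA divff// mulr1 /log2 ln_div ?posrE// mulrA mulrBr.
Qed.

(** The conditional mutual information of the first and last letters given the m letters between
    them is nonnegative. This is Gibbs' inequality for the law p(avb) against its Markov
    approximation p(av) p(vb) / p(v). *)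
Lemma word_entropy_concave m :
  word_entropy m.+2 - word_entropy m.+1 <= word_entropy m.+1 - word_entropy m.
Proof.
pose T := (A * m.-tuple A * A)%type.
have sumT (F : A -> m.-tuple A -> A -> R) :
    \sum_(x : T) F x.1.1 x.1.2 x.2 = \sum_a \sum_v \sum_b F a v b.
  by rewrite pair_bigA pair_bigA.
pose p3 (x : T) := p (x.1.1 :: rcons x.1.2 x.2).
pose q3 (x : T) := p (x.1.1 :: x.1.2) * p (rcons x.1.2 x.2) / p x.1.2.
have p30 x : 0 <= p3 x by exact: seq_prob_ge0.
have p3_av x : p3 x <= p (x.1.1 :: x.1.2) by rewrite /p3 -rcons_cons seq_prob_rcons_le.
have p3_vb x : p3 x <= p (rcons x.1.2 x.2) by exact: seq_prob_cons_le.
have vb_v (x : T) : p (rcons x.1.2 x.2) <= p x.1.2 := seq_prob_rcons_le _ _.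
have sum_p3 (F : seq A -> R) : \sum_x p3 x * F x.1.2 = \sum_(v : m.-tuple A) p v * F v.
  rewrite (sumT (fun a v b => p (a :: rcons v b) * F v)) exchange_big /=.
  apply: eq_bigr => v _; rewrite -(sum_seq_prob_cons P P_stationary v) big_distrl /=.
  apply: eq_bigr => a _; rewrite -(sum_seq_prob_rcons P (a :: v)) big_distrl /=.
  by apply: eq_bigr.
have sum_av (F : seq A -> R) :
    \sum_x p3 x * F (x.1.1 :: x.1.2) = \sum_(u : m.+1.-tuple A) p u * F u.
  rewrite (sumT (fun a v b => p (a :: rcons v b) * F (a :: v))).
  rewrite (sum_word_cons _ (fun u => p u * F u)).
  apply: eq_bigr => a _; apply: eq_bigr => v _.
  by rewrite -(sum_seq_prob_rcons P (a :: v)) big_distrl.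
have sum_vb (F : seq A -> R) :
    \sum_x p3 x * F (rcons x.1.2 x.2) = \sum_(u : m.+1.-tuple A) p u * F u.
  rewrite (sumT (fun a v b => p (a :: rcons v b) * F (rcons v b))).
  rewrite (sum_word_rcons _ (fun u => p u * F u)) exchange_big /=.
  apply: eq_bigr => v _; rewrite exchange_big /=; apply: eq_bigr => b _.
  by rewrite -(sum_seq_prob_cons P P_stationary (rcons v b)) big_distrl.
have Hp3 : \sum_x p3 x * ln (p3 x) = - word_entropy m.+2.
  rewrite /word_entropy opprK (sum_word_cons _ (fun u => p u * ln (p u))).
  under [RHS]eq_bigr => a _ do
    rewrite (sum_word_rcons _ (fun u => p (a :: u) * ln (p (a :: u)))).
  by rewrite (sumT (fun a v b => p (a :: rcons v b) * ln (p (a :: rcons v b)))).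
have Hq3 : \sum_x p3 x * ln (q3 x) =
    - word_entropy m.+1 - word_entropy m.+1 + word_entropy m.
  rewrite /word_entropy !opprK -{1}(sum_av (fun u => ln (p u))).
  rewrite -(sum_vb (fun u => ln (p u))) -(sum_p3 (fun u => ln (p u))).
  rewrite -big_split -sumrB; apply: eq_bigr => x _ /=.
  have [->|x0] := eqVneq (p3 x) 0; first by rewrite !mul0r subr0 addr0.
  have x_gt0 : 0 < p3 x by rewrite lt_neqAle eq_sym x0 p30.
  have vb_gt0 := lt_le_trans x_gt0 (p3_vb x).
  have av_gt0 := lt_le_trans x_gt0 (p3_av x).
  have v_gt0 := lt_le_trans vb_gt0 (vb_v x).
  by rewrite ln_div ?lnM ?posrE ?mulr_gt0// -mulrDr -mulrBr.
have : \sum_x p3 x * ln (q3 x) <= \sum_x p3 x * ln (p3 x).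
  apply: gibbs => // [x|x x_gt0|].
  - by rewrite divr_ge0 ?mulr_ge0 ?seq_prob_ge0.
  - have vb_gt0 := lt_le_trans x_gt0 (p3_vb x).
    have av_gt0 := lt_le_trans x_gt0 (p3_av x).
    by rewrite divr_gt0 ?mulr_gt0// (lt_le_trans vb_gt0).
  (* Summing the Markov weights over a and b leaves p(v) p(v) / p(v), that is p(v), also when p(v) =
     0. *)
  - under [leRHS]eq_bigr do rewrite -[p3 _]mulr1.
    rewrite (sum_p3 (fun=> 1)).
    rewrite (sumT (fun a v b => p (a :: v) * p (rcons v b) / p v)) exchange_big /=.
    apply: ler_sum => v _; rewrite mulr1.
    under eq_bigr => a _.
      rewrite -big_distrl -big_distrr /= sum_seq_prob_rcons.
      over.
    rewrite /= -!mulr_suml sum_seq_prob_cons//.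
    have [->|pv0] := eqVneq (p v) 0; first by rewrite !mul0r.
    by rewrite -mulrA divff// mulr1.
by rewrite Hp3 Hq3; lra.
Qed.

Lemma entropy_ge0 m : 0 <= entropy P m.
Proof.
rewrite /entropy oppr_ge0 -oppr_ge0 -sumrN sumr_ge0// => v _.
rewrite -mulrN mulr_ge0 ?word_probE ?seq_prob_ge0// -sumrN sumr_ge0// => a _.
have c0 : 0 <= cond_prob P v a.
  by rewrite /cond_prob !word_probE divr_ge0 ?seq_prob_ge0.
rewrite -mulrN mulr_ge0// oppr_ge0 /log2 mulr_le0_ge0 ?invr_ge0 ?ln_ge0 ?ler1n//.
apply: ln_le0; rewrite /cond_prob !word_probE.
have [->|pv0] := eqVneq (p v) 0; first by rewrite invr0 mulr0.
by rewrite ler_pdivrMr ?mul1r ?seq_prob_rcons_le// lt_neqAle eq_sym pv0 seq_prob_ge0.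
Qed.

(** By concavity of block entropy the conditional entropies decrease; being nonnegative they
    converge, and the limit lies below every term. *)
Lemma entropy_rate_le m : entropy_rate P <= entropy P m.
Proof.
have ln2 : 0 < ln 2 :> R by rewrite ln_gt0// ltr1n.
have ninc : nonincreasing_seq (entropy P).
  apply/nonincreasing_seqP => n; rewrite !entropyE.
  by rewrite ler_pM2r ?invr_gt0// word_entropy_concave.
apply: nonincreasing_cvgn_ge => //; apply: nonincreasing_is_cvgn => //.
by exists 0 => _ [n _ <-]; exact: entropy_ge0.
Qed.

(** Telescoping: by the chain rule each increment of the block entropy is at least the rate in
    nats. *)
Lemma word_entropy_ge t :
  t%:R * (entropy_rate P * ln 2) <= word_entropy t.
Proof.
have ln2 : 0 < ln 2 :> R by rewrite ln_gt0// ltr1n.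
elim: t => [|t IH]; first by rewrite mul0r word_entropy0.
have := entropy_rate_le t; rewrite entropyE ler_pdivlMr//.
by rewrite -[t.+1%:R]natr1 mulrDl mul1r; lra.
Qed.

End Entropy.

(** * Weighted parsings of words *)

Lemma sum_word_take_drop (R : pzSemiRingType) (A : finType) (F G : seq A -> R) n N :
  (n <= N)%N ->
  \sum_(u : N.-tuple A) F (take n u) * G (drop n u) =
  (\sum_(u : n.-tuple A) F u) * (\sum_(u : (N - n).-tuple A) G u).
Proof.
move=> nN; have [m ->] : exists m, N = (n + m)%N by exists (N - n)%N; rewrite subnKC.
by rewrite addKn sum_word_cat.
Qed.

Section ParseWeight.
Context {R : realType} {A : finType} (M : nat) (w : seq A -> R).

(* Total weight of all ways to cut [s] into single letters, each of weight
   1/|A|, and blocks [b] of length at least [M], each of weight [w b]; [f] only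
   bounds the recursion and is irrelevant as soon as [size s <= f]. *)
Fixpoint parse_weight (f : nat) (s : seq A) : R :=
  if f is f'.+1 then
    if s is _ :: s' then
      #|A|%:R^-1 * parse_weight f' s' +
      \sum_(M <= n < (size s).+1) w (take n s) * parse_weight f' (drop n s)
    else 1
  else 1.

Hypothesis w_ge0 : forall s, 0 <= w s.
Hypothesis M_gt0 : (0 < M)%N.

Lemma parse_weight_ge0 f s : 0 <= parse_weight f s.
Proof.
elim: f s => [|f IH] [|a s] //=.
by rewrite addr_ge0 ?mulr_ge0 ?invr_ge0// sumr_ge0// => n _; rewrite mulr_ge0.
Qed.

Lemma parse_weight_letters_le f s :
  (size s <= f)%N -> #|A|%:R^-1 ^+ size s <= parse_weight f s.
Proof.
elim: f s => [|f IH] [|a s] //= sf; rewrite exprS ler_wpDr//.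
  by rewrite sumr_ge0// => n _; rewrite mulr_ge0// parse_weight_ge0.
by rewrite ler_wpM2l ?invr_ge0// IH.
Qed.

(** Give each letter of length an extra factor r. Starting with a single letter then costs r in
    total, and starting with a block costs at most the sum of r^n over n >= M, that is r^M / (1 - r)
    <= 1 - r. The two add up to at most 1, and induction handles the rest of the word. *)
Lemma sum_parse_weight_le (r : R) f N :
  (forall n, \sum_(u : n.-tuple A) w u <= 1) ->
  0 < r < 1 -> r ^+ M <= (1 - r) ^+ 2 -> (0 < #|A|)%N ->
  (N <= f)%N -> r ^+ N * \sum_(u : N.-tuple A) parse_weight f u <= 1.
Proof.
move=> w1 /andP[r0 r1] rM A0.
have geom k : (1 - r) * \sum_(M <= n < k) r ^+ n <= r ^+ M.
  have [kM|Mk] := leqP k M; first by rewrite big_geq// mulr0 exprn_ge0// ltW.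
  suff -> : (1 - r) * \sum_(M <= n < k) r ^+ n = r ^+ M - r ^+ k.
    by rewrite gerBl exprn_ge0// ltW.
  rewrite -(subnKC (ltnW Mk)); elim: (k - M)%N => [|j IH].
    by rewrite addn0 big_geq// mulr0 subrr.
  by rewrite addnS big_nat_recr ?leq_addr//= mulrDr IH exprS; ring.
elim: f N => [|f IH] [|N] // Nf.
- by rewrite (sum_word0 (parse_weight 0)) expr0 mul1r.
- by rewrite (sum_word0 (parse_weight f.+1)) expr0 mul1r.
under eq_bigr => u _.
  have -> : parse_weight f.+1 u = #|A|%:R^-1 * parse_weight f (behead u) +
      \sum_(M <= n < N.+2) w (take n u) * parse_weight f (drop n u).
    by case: u => -[|a s]//= /eqP[<-].
  over.
rewrite big_split/= mulrDr.
rewrite (sum_word_cons _ (fun u => #|A|%:R^-1 * parse_weight f (behead u))) /=.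
rewrite sumr_const -big_distrr/= -[_ *+ _]mulr_natr mulrAC mulVf ?pnatr_eq0 -?lt0n//.
rewrite mul1r exchange_big/= [X in _ + X]big_distrr/=.
(* The share r pays for parsings starting with a letter, the share 1 - r for those starting with a
   block. *)
have -> : 1 = r + (1 - r) by rewrite addrC subrK.
apply: lerD; first by rewrite exprS -mulrA ler_piMr ?IH// ltW.
rewrite -(ler_pM2l (_ : 0 < 1 - r)) ?subr_gt0// -expr2.
apply: le_trans rM; apply: le_trans (geom N.+2).
have r_ge0 := ltW r0; have r_le1 := ltW r1.
rewrite ler_wpM2l ?subr_ge0// big_nat_cond [leRHS]big_nat_cond.
apply: ler_sum => n; rewrite andbT => /andP[Mn]; rewrite ltnS => nN.
rewrite sum_word_take_drop// -{1}(subnKC nN) exprD -mulrA ler_piMr ?exprn_ge0//.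
rewrite mulrCA mulr_ile1//.
- by rewrite sumr_ge0.
- by rewrite mulr_ge0 ?exprn_ge0// sumr_ge0// => u _; exact: parse_weight_ge0.
- by rewrite IH//; lia.
Qed.

Variable c : R.

Definition no_heavy_prefix (s : seq A) : bool :=
  ~~ has (fun n => expR (- (c * n%:R)) <= w (take n s)) (index_iota M (size s).+1).

Definition bad_count (L N : nat) (s : seq A) : nat :=
  \sum_(0 <= i < N) no_heavy_prefix (take L (drop i s)).

(* Parse [take N s] greedily: a heavy block where there is one, a single letter
   elsewhere and near the end. *)
Lemma parse_weight_ge L f N s :
  0 <= c -> (0 < #|A|)%N -> (N <= f)%N -> (N + L <= size s)%N ->
  expR (- (c * N%:R)) * #|A|%:R^-1 ^+ (bad_count L N s + L)
    <= parse_weight f (take N s).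
Proof.
move=> c0 A0.
have i0 : 0 <= #|A|%:R^-1 :> R by rewrite invr_ge0.
have i1 : #|A|%:R^-1 <= 1 :> R by rewrite invf_le1 ?ler1n ?ltr0n.
have e1 n : expR (- (c * n%:R)) <= 1 by rewrite expR_le1 oppr_le0 mulr_ge0.
elim: f N s => [|f IH] [|N] s //.
- by move=> _ _; rewrite take0 mulr_ile1 ?expR_ge0 ?exprn_ge0 ?exprn_ile1.
- by move=> _ _; rewrite take0 mulr_ile1 ?expR_ge0 ?exprn_ge0 ?exprn_ile1.
rewrite ltnS => Nf; case: s => // a s sz.
have szs : (N + L <= size s)%N by move: sz; rewrite addSn ltnS.
have szL : size (take L (a :: s)) = L by rewrite size_takel//; lia.
have szN : size (take N s) = N by rewrite size_takel//; lia.
have term_ge0 n : 0 <= w (take n (a :: take N s)) *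
    parse_weight f (drop n (a :: take N s)).
  by rewrite mulr_ge0// parse_weight_ge0.
(* At a bad position one letter is split off; its factor 1/|A| is the one recorded by
   [bad_count]. *)
have [bad|] := boolP (no_heavy_prefix (take L (a :: s))).
  have -> : bad_count L N.+1 (a :: s) = (bad_count L N s).+1.
    by rewrite /bad_count big_nat_recl//= bad.
  rewrite /= ler_wpDr//; first by rewrite sumr_ge0.
  rewrite addSn exprS mulrCA ler_wpM2l//; apply: le_trans (IH _ _ Nf szs).
  rewrite ler_wpM2r ?exprn_ge0// ler_expR lerN2 ler_wpM2l//.
  by rewrite ler_nat.
rewrite negbK => /hasP[n]; rewrite mem_index_iota szL ltnS => /andP[Mn nL].
rewrite take_takel// => heavy.
(* If the heavy block overshoots the end, fewer than L letters remain; they are taken singly and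
   charged to the extra exponent L. *)
have [nN|Nn] := leqP n N.+1; last first.
  apply: le_trans (parse_weight_letters_le _ _ _); last by rewrite /= szN.
  rewrite /= szN; apply: (@le_trans _ _ (#|A|%:R^-1 ^+ (bad_count L N.+1 (a :: s) + L))).
    by rewrite ler_piMl// exprn_ge0.
  by rewrite ler_wiXn2l//; lia.
rewrite /= ler_wpDl ?mulr_ge0 ?parse_weight_ge0// szN.
rewrite (bigD1_seq n) ?mem_index_iota ?iota_uniq//=; last by rewrite Mn ltnS.
rewrite ler_wpDr ?sumr_ge0//.
have -> : a :: take N s = take N.+1 (a :: s) by [].
rewrite take_takel//.
have -> : drop n (take N.+1 (a :: s)) = take (N.+1 - n) (drop n (a :: s)).
  by rewrite take_drop subnK.
have -> : expR (- (c * N.+1%:R)) =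
    expR (- (c * n%:R)) * expR (- (c * (N.+1 - n)%:R)).
  by rewrite -expRD -opprD -mulrDr -natrD subnKC.
rewrite -mulrA ler_pM ?expR_ge0 ?mulr_ge0 ?expR_ge0 ?exprn_ge0//.
apply: le_trans (IH (N.+1 - n)%N _ _ _); last 2 first.
- by lia.
- by rewrite size_drop /=; lia.
(* The bad positions after the block are among those of the whole word, so the exponent only
   drops. *)
rewrite ler_wpM2l ?expR_ge0// ler_wiXn2l// leq_add2r /bad_count.
rewrite [leqRHS](big_cat_nat (n := n))//=.
rewrite -[X in (_ <= _ + \sum_(X <= _ < _) _)%N](add0n n) big_addn.
apply: leq_trans (leq_addl _ _); apply: leq_sum => i _.
by rewrite drop_drop.
Qed.

End ParseWeight.

(** * Entropy bound from heavy words *)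

Lemma le0_of_bounded_multiples (R : realType) (a b : R) :
  (forall n : nat, n%:R * a <= b) -> a <= 0.
Proof.
move=> h; rewrite leNgt; apply/negP => a0.
have := h (Num.truncn (b / a)).+1; rewrite leNgt -ltr_pdivrMr//.
by rewrite truncnS_gt.
Qed.

Section EntropyOfHeavyWords.
Context {R : realType} {A : finType} {a0 : A} (P : probability (seq_space a0) R).
Hypothesis P_stationary : stationary P.
Local Notation p := (seq_prob P).

Lemma sum_seq_prob_take n N (F : seq A -> R) : (n <= N)%N ->
  \sum_(v : N.-tuple A) p v * F (take n v) = \sum_(u : n.-tuple A) p u * F u.
Proof.
move=> nN; rewrite -(subnKC nN); elim: (N - n)%N => [|m IH].
  rewrite addn0; apply: eq_bigr => u _.
  by rewrite take_oversize// size_tuple.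
rewrite addnS (sum_word_rcons _ (fun v => p v * F (take n v))) -{}IH.
apply: eq_bigr => v _; rewrite -(sum_seq_prob_rcons P v) big_distrl/=.
apply: eq_bigr => a _; rewrite -cats1 takel_cat//.
by rewrite size_tuple leq_addr.
Qed.

Lemma sum_seq_prob_drop n m (F : seq A -> R) :
  \sum_(v : (n + m).-tuple A) p v * F (drop n v) = \sum_(u : m.-tuple A) p u * F u.
Proof.
elim: n => [|n IH]; first by apply: eq_bigr => u _; rewrite drop0.
rewrite (sum_word_cons _ (fun v => p v * F (drop n.+1 v))) -{}IH exchange_big/=.
by apply: eq_bigr => v _; rewrite -(sum_seq_prob_cons P P_stationary v) big_distrl.
Qed.

(** Letters to the left of the window are summed out by stationarity, those to its right by
    additivity. *)
Lemma sum_seq_prob_window i L N (F : seq A -> R) : (i + L <= N)%N ->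
  \sum_(v : N.-tuple A) p v * F (take L (drop i v)) =
  \sum_(u : L.-tuple A) p u * F u.
Proof.
move=> iLN; have [m ->] : exists m, N = (i + (L + m))%N.
  by exists (N - (i + L))%N; rewrite addnA subnKC.
rewrite (sum_seq_prob_drop _ _ (fun v => F (take L v))) sum_seq_prob_take//.
exact: leq_addr.
Qed.

Variables (M L : nat) (c : R).
Let light := no_heavy_prefix M p c.

Definition light_prob : R := \sum_(u : L.-tuple A) p u * (light u)%:R.

(** Gibbs' inequality against the parsing weights: their total mass is at most r^-N, and the greedy
    parsing bounds the expected -ln of the weight. *)
Lemma word_entropy_le_heavy (r : R) (N : nat) :
  (0 < M)%N -> 0 <= c -> 0 < r < 1 -> r ^+ M <= (1 - r) ^+ 2 ->
  word_entropy P N <=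
    N%:R * c + (N%:R * light_prob + L%:R) * ln #|A|%:R - N%:R * ln r.
Proof.
move=> M0 c0 r01 rM; have /andP[r0 r1] := r01.
have A0 : (0 < #|A|)%N by apply/card_gt0P; exists a0.
have A0' : 0 < #|A|%:R :> R by rewrite ltr0n.
pose q s := parse_weight M p N s.
have qL (u : N.-tuple A) : #|A|%:R^-1 ^+ N <= q u.
  rewrite -{1}(size_tuple u) parse_weight_letters_le ?size_tuple//.
  exact: seq_prob_ge0.
have q0 (u : N.-tuple A) : 0 < q u.
  by apply: lt_le_trans (qL u); rewrite exprn_gt0// invr_gt0.
have sum_q : 0 < \sum_(u : N.-tuple A) q u.
  rewrite (bigD1 [tuple of nseq N a0])//= ltr_pwDl// sumr_ge0// => u _.
  exact: ltW.
have /(ln_le0) : r ^+ N * \sum_(u : N.-tuple A) q u <= 1.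
  apply: sum_parse_weight_le => //; first exact: seq_prob_ge0.
  by move=> n; rewrite sum_seq_prob.
rewrite lnM ?posrE ?exprn_gt0// lnXn// -[_ *+ _]mulr_natl => ln_sum.
have gib := @gibbs_unnormalized R (N.-tuple A : finType) p q
  (fun u => seq_prob_ge0 P u) q0 (sum_seq_prob P N).
suff : - (N%:R * c + (N%:R * light_prob + L%:R) * ln #|A|%:R) <=
    \sum_(u : N.-tuple A) p u * ln (q u).
  by rewrite /word_entropy; move: gib ln_sum => /=; lra.
(* Words of length N + L provide a full window of length L at each of the N positions. *)
rewrite -(@sum_seq_prob_take N (N + L) (fun u => ln (q u))) ?leq_addr//.
apply: (@le_trans _ _ (\sum_(v : (N + L).-tuple A) p v *
   - (c * N%:R + (bad_count M p c L N v + L)%:R * ln #|A|%:R))).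
  rewrite le_eqVlt; apply/orP; left; apply/eqP.
  under [RHS]eq_bigr do rewrite mulrN.
  rewrite sumrN; congr (- _).
  (* Linearity of expectation: by stationarity each position is bad with probability
     [light_prob]. *)
  have -> : N%:R * light_prob =
      \sum_(v : (N + L).-tuple A) p v * (bad_count M p c L N v)%:R.
    under [RHS]eq_bigr do rewrite /bad_count natr_sum big_distrr/=.
    rewrite exchange_big/= big_nat.
    under eq_bigr => i /andP[_ iN].
      rewrite (@sum_seq_prob_window i L (N + L) (fun u => (light u)%:R)).
        over.
      by rewrite leq_add2r ltnW.
    by rewrite -big_nat sumr_const_nat subn0 mulr_natl.
  under [RHS]eq_bigr do rewrite mulrDr mulrA natrD mulrDl mulrDr !mulrA.
  rewrite big_split/= -!mulr_suml sum_seq_prob mul1r big_split/= -!mulr_suml.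
  by rewrite sum_seq_prob mul1r mulrDl mulrC.
apply: ler_sum => v _; rewrite ler_wpM2l ?seq_prob_ge0//.
have := @parse_weight_ge R A M p (seq_prob_ge0 P) M0 c L N N v c0 A0 (leqnn _).
rewrite size_tuple => /(_ (leqnn _)) h.
have h0 : 0 < expR (- (c * N%:R)) * #|A|%:R^-1 ^+ (bad_count M p c L N v + L).
  by rewrite mulr_gt0 ?expR_gt0 ?exprn_gt0 ?invr_gt0.
move: (h); rewrite -ler_ln ?posrE ?(lt_le_trans h0)//; apply: le_trans.
rewrite lnM ?posrE ?expR_gt0 ?exprn_gt0 ?invr_gt0// expRK lnXn ?invr_gt0//.
by rewrite lnV ?posrE// -[- _ *+ _]mulr_natl opprD mulrN.
Qed.

(** N times the difference of the two sides is at most L ln |A| for every N, so the boundary term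
    vanishes in the limit. *)
Lemma entropy_rate_le_heavy (r : R) :
  (0 < M)%N -> 0 <= c -> 0 < r < 1 -> r ^+ M <= (1 - r) ^+ 2 ->
  entropy_rate P * ln 2 <= c + light_prob * ln #|A|%:R - ln r.
Proof.
move=> M0 c0 r01 rM; rewrite -subr_le0.
apply: (@le0_of_bounded_multiples _ _ (L%:R * ln #|A|%:R)) => N.
have := word_entropy_ge P P_stationary N.
have := word_entropy_le_heavy r N M0 c0 r01 rM; lra.
Qed.

End EntropyOfHeavyWords.

(** * Almost sure bounds on word probabilities *)

Section AlmostSureBounds.
Context {R : realType} {A : finType} {a0 : A} (P : probability (seq_space a0) R).
Local Notation p := (seq_prob P).

Lemma measurable_shift_preimage (E : set (seq_space a0)) :
  measurable E -> measurable (@Defs.shift A @^-1` E : set (seq_space a0)).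
Proof.
suff mT : measurable_fun [set: seq_space a0] (@Defs.shift A : seq_space a0 -> seq_space a0).
  by move=> mE; rewrite -[X in measurable X]setTI; exact: mT.
apply: (@measurability _ _ _ (seq_space a0) _ _ (cylinders a0)) => // _ [_ [t [u ->]] <-].
rewrite setTI (_ : _ @^-1` _ = [set x | behead (first_letters t.+1 x) = u]).
  exact: (@measurable_first_letters _ _ t.+1 (fun v => behead v = u)).
by rewrite cylinderE; apply/seteqP; split => x; rewrite /preimage/= first_letters_mkseq mkseq_shift.
Qed.

Lemma measurable_iter_shift_preimage m (E : set (seq_space a0)) :
  measurable E -> measurable (iter m (@Defs.shift A) @^-1` E : set (seq_space a0)).
Proof.
elim: m E => // m IH E mE.
exact: (IH (@Defs.shift A @^-1` E)) (measurable_shift_preimage _ mE).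
Qed.

Lemma ae_eventually (Q : nat -> set (seq_space a0)) :
  P.-negligible (lim_sup_set (fun n => ~` Q n)) ->
  {ae P, forall x : seq_space a0, \forall n \near \oo, Q n x}.
Proof.
apply: negligibleS => x /= nQ k _; apply: contrapT => h; apply: nQ.
exists k => // n /= kn; apply: contrapT => nQ; apply: h.
by exists n.
Qed.

Hypothesis P_stationary : stationary P.
Hypothesis P_ergodic : ergodic P.

Lemma prob_iter_shift m (E : set (seq_space a0)) :
  measurable E -> P (iter m (@Defs.shift A) @^-1` E) = P E.
Proof.
elim: m E => // m IH E mE; rewrite -[RHS]P_stationary//.
exact: (IH (@Defs.shift A @^-1` E)) (measurable_shift_preimage _ mE).
Qed.

(** The iterated preimages of G increase and all have probability P G; their union is strictly
    invariant and has the same probability, so ergodicity applies to it. *)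
Lemma zero_one_subinvariant (G : set (seq_space a0)) : measurable G ->
  G `<=` @Defs.shift A @^-1` G -> P G = 0%E \/ P G = 1%E.
Proof.
move=> mG GsG; pose F m : set (seq_space a0) := iter m (@Defs.shift A) @^-1` G.
have mF m : measurable (F m) by exact: measurable_iter_shift_preimage.
have mU : measurable (\bigcup_m F m) by exact: bigcup_measurable.
have Fle m n : (m <= n)%N -> F m `<=` F n.
  move=> mn; rewrite -(subnKC mn); elim: (n - m)%N => [|k IH]; first by rewrite addn0.
  by apply: subset_trans IH _; rewrite addnS => x; exact: GsG.
have <- : P (\bigcup_m F m) = P G.
  have /cvg_lim <-// := @nondecreasing_cvg_mu _ _ _ P F mF mU
    (fun m n mn => introT (subsetPset _ _) (Fle m n mn)).
  rewrite [X in lim (X @ _)](_ : _ = (fun=> P G)); first exact: lim_cst.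
  by apply/funext => m /=; exact: prob_iter_shift.
apply: P_ergodic => //; apply/seteqP; split => [x [m _ Fx]|x [m _ Fx]].
  by exists m.+1 => //; move: Fx; rewrite /F /preimage /= -iterSr.
by exists m => //; rewrite /F /preimage /= -iterSr; exact: GsG.
Qed.

Let heavy_io (c : R) (K : nat) : set (seq_space a0) :=
  lim_sup_set (fun n => [set x | expR (- (c * n%:R + K%:R)) <= p (mkseq x n)]).

Let measurable_prefix_event n (Q : set (seq A)) :
  measurable ([set x | Q (mkseq x n)] : set (seq_space a0)).
Proof.
rewrite (_ : [set x | _] = [set x | Q (first_letters n x)]).
  exact: (@measurable_first_letters _ _ n (fun u => Q u)).
by apply/seteqP; split => x /=; rewrite first_letters_mkseq.
Qed.

Let measurable_heavy_io c K : measurable (heavy_io c K).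
Proof.
apply: bigcap_measurable => // k _; apply: bigcup_measurable => n _.
exact: (measurable_prefix_event n (fun s => expR (- (c * n%:R + K%:R)) <= p s)).
Qed.

(* The constant factor e^-K makes the event subinvariant under the shift. *)
Let heavy_io_shift c : 0 <= c ->
  \bigcup_K heavy_io c K `<=` @Defs.shift A @^-1` (\bigcup_K heavy_io c K).
Proof.
(* Removing the first letter turns n + 1 into n and costs a factor e^-c, absorbed by raising K by
   more than c. *)
move=> c0 x [K _ xK]; exists (K + (Num.truncn c).+1)%N => // m _.
have [[|n] /= mn hx] := xK m.+1 I; first by [].
exists n => //=; apply: (le_trans _ (seq_prob_cons_le P P_stationary (x 0%N) _)).
rewrite -mkseq_shift; apply: (le_trans _ hx); rewrite ler_expR lerN2 -[n.+1%:R]natr1 natrD.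
by have := truncnS_gt c; lra.
Qed.

(** By the zero-one law it suffices to exclude probability 1. In that case long windows almost
    always start with a heavy block, and the entropy bound contradicts c < h. *)
Lemma heavy_io_null c : 0 <= c -> c < entropy_rate P * ln 2 ->
  P (\bigcup_K heavy_io c K) = 0%E.
Proof.
move=> c0 ch.
set G := \bigcup_K _; have mG : measurable G by exact: bigcup_measurable.
have [//|G1] := zero_one_subinvariant G mG (heavy_io_shift _ c0).
exfalso; pose h := entropy_rate P * ln 2; pose c' := (c + h) / 2.
(* The gap c' - c will absorb the factor e^-K. One half of the gap h - c' is spent on -ln r, the
   other on the light windows. *)
have c'h : c' < h by rewrite /c' /h; lra.
have cc' : c < c' by rewrite /c' /h; lra.
pose r := expR (- ((h - c') / 2)).
have r01 : 0 < r < 1 by rewrite expR_gt0 expR_lt1; lra.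
have [M M0 rM] : exists2 M, (0 < M)%N & r ^+ M <= (1 - r) ^+ 2.
  have /cvgr0Pnorm_le : (r ^+ n) @[n --> \oo] --> 0.
    by apply: cvg_expr; rewrite ger0_norm; lra.
  have r2 : 0 < (1 - r) ^+ 2 by rewrite exprn_gt0//; lra.
  move=> /(_ _ r2) [N _ hN]; exists N.+1 => //.
  by apply: le_trans (hN N.+1 _) => //=; rewrite ler_norm.
pose light L : set (seq_space a0) :=
  [set x | no_heavy_prefix M p c' (first_letters L x)].
have mlight L : measurable (light L).
  exact: (@measurable_first_letters _ _ L (fun u => no_heavy_prefix M p c' u)).
have lightE L : P (light L) = (light_prob P M L c')%:E.
  rewrite (prob_first_letters P L (fun u => no_heavy_prefix M p c' u)) /light_prob big_mkcond/=; congr EFin.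
  by apply: eq_bigr => u _; case: ifP => _; rewrite ?mulr1 ?mulr0.
have lightP L x : light L x <->
    forall n, (M <= n <= L)%N -> p (mkseq x n) < expR (- (c' * n%:R)).
  rewrite /light /= /no_heavy_prefix first_letters_mkseq size_mkseq; split.
    move=> /hasPn hn n /andP[Mn nL]; have := hn n.
    by rewrite mem_index_iota Mn ltnS nL take_mkseq// -ltNge; exact.
  move=> hn; apply/hasPn => n; rewrite mem_index_iota ltnS => MnL.
  by have /andP[Mn nL] := MnL; rewrite take_mkseq// -ltNge hn.
have mcap : measurable (\bigcap_L light L) by exact: bigcap_measurable.
(* Every point of G has a prefix that is heavy for c', so only the null complement of G stays light
   for all L. *)
have cap0 : P (\bigcap_L light L) = 0%E.
  apply/eqP; rewrite eq_le measure_ge0 andbT.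
  apply: (@le_trans _ _ (P (~` G))); last first.
    by rewrite probability_setC// G1 subee.
  apply: le_measure; rewrite ?inE//; first exact: measurableC.
  move=> x lx [K _ xK].
  (* For n >= m both n >= M and cn + K <= c'n hold. *)
  pose m := maxn M (Num.truncn (K%:R / (c' - c))).+1.
  have [n /= mn] := xK m I; apply/negP; rewrite -ltNge.
  have Mn : (M <= n)%N by apply: leq_trans mn; rewrite leq_maxl.
  apply: (lt_le_trans ((lightP n x).1 (lx n I) n _)); first by rewrite Mn leqnn.
  rewrite ler_expR lerN2 -lerBrDl -mulrBl mulrC -ler_pdivrMr ?subr_gt0//.
  apply: ltW; apply: (lt_le_trans (truncnS_gt _)).
  by rewrite ler_nat (leq_trans _ mn)// leq_maxr.
have light0 : light_prob P M L c' @[L --> \oo] --> 0.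
  have lt1 : (P (light 0%N) < +oo)%E.
    by apply: (le_lt_trans (probability_le1 _ _)); rewrite ?ltry.
  have lightS m n : (m <= n)%N -> light n `<=` light m.
    move=> mn x /lightP hx; apply/lightP => k /andP[Mk km]; apply: hx.
    by rewrite Mk (leq_trans km).
  have : P (light L) @[L --> \oo] --> 0%E.
    rewrite -cap0; apply: (@nonincreasing_cvg_mu _ _ _ P light lt1 mlight mcap).
    by move=> m n mn; apply/subsetPset; exact: lightS.
  move=> /fine_cvg; apply: cvg_trans; apply: near_eq_cvg.
  by near=> L; rewrite /= lightE.
have K0 : 0 <= ln #|A|%:R :> R.
  by rewrite ln_ge0// ler1n; apply/card_gt0P; exists a0.
have lim : light_prob P M L c' * ln #|A|%:R @[L --> \oo] --> 0.
  by rewrite -(mul0r (ln #|A|%:R)); apply: cvgMl.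
have e0 : 0 < (h - c') / 2 by lra.
have /cvgr0Pnorm_lt/(_ _ e0)[L _ /(_ L (leqnn _))/=] := lim.
move=> /(le_lt_trans (ler_norm _)).
have := entropy_rate_le_heavy P P_stationary M L c' r M0 (le_trans c0 (ltW cc')) r01 rM.
by rewrite -/h /r expRK; lra.
Unshelve. all: by end_near. Qed.

Lemma ae_seq_prob_lt c : c < entropy_rate P * ln 2 ->
  {ae P, forall x : seq_space a0,
    \forall n \near \oo, p (mkseq x n) < expR (- (c * n%:R))}.
Proof.
move=> ch.
apply: (@ae_eventually (fun n => [set x | p (mkseq x n) < expR (- (c * n%:R))])).
have [c0|c0] := leP 0 c.
  apply: (@negligibleS _ _ _ _ (\bigcup_K heavy_io c K)).
    move=> x hx; exists 0%N => // k /(hx k)[n kn /negP]; rewrite -leNgt => h.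
    by exists n => //=; rewrite addr0.
  apply/negligibleP; last exact: heavy_io_null.
  exact: bigcup_measurable.
(* For c < 0 the bound exceeds 1 as soon as n >= 1, so no point is exceptional. *)
apply: negligibleS (negligible_set0 P) => x /(_ 1%N I)[n /= n1 []].
rewrite (@le_lt_trans _ _ 1)//; last by rewrite expR_gt1 oppr_gt0 nmulr_rlt0// ltr0n.
rewrite -(sum_seq_prob P n) -first_letters_mkseq (bigD1 (first_letters n x))//=.
by rewrite lerDl sumr_ge0// => u _; exact: seq_prob_ge0.
Qed.

(** On the exceptional words p is below q e^(-et), so their total probability is at most e^(-et).
    This is summable and Borel-Cantelli applies. *)
Lemma ae_subprob_le (q : forall t, t.-tuple A -> R) (e : R) : 0 < e ->
  (forall t u, 0 <= q t u) ->
  (forall t, (0 < t)%N -> \sum_(u : t.-tuple A) q t u <= 1) ->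
  {ae P, forall x : seq_space a0, \forall t \near \oo,
    q t (first_letters t x) <= p (mkseq x t) * expR (e * t%:R)}.
Proof.
move=> e0 q0 q1.
pose Q t : set (seq_space a0) :=
  [set x | q t (first_letters t x) <= p (mkseq x t) * expR (e * t%:R)].
pose bad t (u : t.-tuple A) := p u * expR (e * t%:R) < q t u.
have QE t : ~` Q t = [set x | bad t (first_letters t x)].
  apply/seteqP; split => x; rewrite /Q /bad /= first_letters_mkseq.
    by move=> /negP; rewrite -ltNge.
  by rewrite ltNge => /negP.
have mQ t : measurable (~` Q t).
  by rewrite QE; exact: (@measurable_first_letters _ _ t (fun u => bad t u)).
apply: (@ae_eventually Q); apply/negligibleP.
  by apply: bigcap_measurable => // k _; apply: bigcup_measurable.
apply: lim_sup_set_cvg0 => //.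
pose z := expR (- e).
have z0 : 0 <= z by exact: expR_ge0.
apply: (@le_lt_trans _ _ (\sum_(0 <= n <oo) (geometric 1 z n)%:E)%E).
  apply: lee_nneseries => // n _; rewrite /geometric /= mul1r.
  (* At length 0 the mass of q is not controlled, but the geometric term is 1. *)
  have [->|n0] := posnP n; first by rewrite expr0 probability_le1.
  rewrite QE prob_first_letters lee_fin /z -expRM_natl mulrN mulrC expRN.
  rewrite -(ler_pM2r (expR_gt0 (e * n%:R))) mulVf ?gt_eqF ?expR_gt0//.
  apply: le_trans (q1 n n0); rewrite mulr_suml [leRHS](bigID (bad n))/=.
  by rewrite ler_wpDr ?sumr_ge0//; apply: ler_sum => u /ltW.
have cz : cvgn (series (geometric 1 z)).
  by apply: is_cvg_geometric_series; rewrite ger0_norm// expR_lt1 oppr_lt0.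
rewrite (_ : (\sum_(0 <= n <oo) _)%E = (limn (series (geometric 1 z)))%:E) ?ltry//.
rewrite -EFin_lim//; congr (limn _); apply/funext => n /=.
by rewrite sumEFin.
Qed.

End AlmostSureBounds.

(** * Redundancy of the code and its Kraft sum *)

Section Redundancy.
Context {R : realType} {A : finType} {a0 : A} (P : probability (seq_space a0) R).
Variable U : code_maps A.
Hypothesis U_code : is_code U.
Hypothesis P_stationary : stationary P.
Local Notation p := (seq_prob P).

Definition code_length (t : nat) (x : nat -> A) : nat := size (U t (first_letters t x)).

Definition mean_length (t : nat) : R :=
  \sum_(u : t.-tuple A) p u * (size (U t u))%:R.

Definition kraft_sum (t : nat) : R := \sum_(u : t.-tuple A) 2 ^- size (U t u).

Let ln2_gt0 : 0 < ln 2 :> R. Proof. by rewrite ln_gt0// ltr1n. Qed.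

Lemma kraft_sum_gt0 t : 0 < kraft_sum t.
Proof.
rewrite /kraft_sum (bigD1 [tuple of nseq t a0])//= ltr_pwDl ?invr_gt0 ?exprn_gt0//.
by rewrite sumr_ge0// => u _; rewrite invr_ge0 exprn_ge0.
Qed.

Lemma log2_kraft_sum_le0 t : (0 < t)%N -> log2 (kraft_sum t) <= 0.
Proof.
move=> t0; rewrite /log2 pmulr_lle0 ?invr_gt0//; apply: ln_le0.
exact: kraft_mcmillan.
Qed.

Lemma log2_code_weight k : log2 (2 ^- k : R) = - k%:R.
Proof.
by rewrite /log2 lnV ?posrE ?exprn_gt0// lnXn// mulNr -[_ *+ _]mulr_natl mulfK ?gt_eqF.
Qed.

Lemma log2_mu t (u : t.-tuple A) :
  log2 (mu R U u) = - (size (U t u))%:R - log2 (kraft_sum t).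
Proof.
rewrite -log2_code_weight /log2 -mulrBl /mu ln_div ?posrE ?invr_gt0 ?exprn_gt0//.
exact: kraft_sum_gt0.
Qed.

Lemma mu_gt0 t (u : t.-tuple A) : 0 < mu R U u.
Proof. by rewrite /mu divr_gt0 ?invr_gt0 ?exprn_gt0//; exact: kraft_sum_gt0. Qed.

(** Normalisation gives -log mu = |U| + log Z_t for every word; then average over P. *)
Lemma divergence_mu t :
  \sum_(u : t.-tuple A) word_prob P u * log2 (word_prob P u / mu R U u) =
  mean_length t + log2 (kraft_sum t) - word_entropy P t / ln 2.
Proof.
have -> : log2 (kraft_sum t) = \sum_(u : t.-tuple A) p u * log2 (kraft_sum t).
  by rewrite -mulr_suml sum_seq_prob mul1r.
rewrite /word_entropy mulNr opprK mulr_suml /mean_length -!big_split/=.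
apply: eq_bigr => u _; rewrite word_probE.
have [->|pu0] := eqVneq (p u) 0; first by rewrite !mul0r !addr0.
have pu_gt0 : 0 < p u by rewrite lt_neqAle eq_sym pu0 seq_prob_ge0.
have -> : log2 (p u / mu R U u) = log2 (p u) - log2 (mu R U u).
  by rewrite /log2 -mulrBl ln_div ?posrE ?mu_gt0.
by rewrite log2_mu /log2; ring.
Qed.

(** Gibbs' inequality against the weights 2^-|U(u)|. Read as a lower bound on log Z_t, it
    complements the upper bound 0 from Kraft-McMillan. *)
Lemma divergence_mu_ge0 t :
  0 <= mean_length t + log2 (kraft_sum t) - word_entropy P t / ln 2.
Proof.
have q0 (u : t.-tuple A) : 0 < 2 ^- size (U t u) :> R by rewrite invr_gt0 exprn_gt0.
have := @gibbs_unnormalized R (t.-tuple A : finType) p _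
  (fun u => seq_prob_ge0 P u) q0 (sum_seq_prob P t).
have -> : \sum_(u : t.-tuple A) p u * ln (2 ^- size (U t u)) =
    - (mean_length t * ln 2).
  rewrite /mean_length mulr_suml -sumrN; apply: eq_bigr => u _.
  by rewrite lnV ?posrE ?exprn_gt0// lnXn// mulrN -[_ *+ _]mulr_natl mulrA.
rewrite -/(kraft_sum t) => gib.
rewrite -(pmulr_lge0 _ ln2_gt0) mulrBl mulrDl divfK ?gt_eqF//.
rewrite /log2 divfK ?gt_eqF// /word_entropy.
by move: gib => /=; lra.
Qed.

Lemma expectation_code_length t :
  ('E_P[fun x : seq_space a0 => (code_length t x)%:R])%E = (mean_length t)%:E.
Proof.
by rewrite unlock; exact: (integral_first_letters P t (fun u => (size (U t u))%:R)).
Qed.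

End Redundancy.

(** * Convergence of the redundancy, in mean and almost surely *)

Theorem theorem2 (R : realType) (A : finType) (a0 : A) (U : code_maps A)
    (hU : universal_code R a0 U) (P : probability (seq_space a0) R)
    (hstat : stationary P) (herg : ergodic P) :
  {ae P, forall x : seq_space a0,
    (t%:R^-1 * (- log2 (word_prob P (first_letters t x))
                - (- log2 (mu R U (first_letters t x)))) : R)
      @[t --> \oo] --> (0 : R)} /\
  (t%:R^-1 * \sum_(u : t.-tuple A)
       word_prob P u * log2 (word_prob P u / mu R U u) : R)
    @[t --> \oo] --> (0 : R).
Proof.
have [U_code /(_ P hstat herg)[ae_len mean_len]] := hU.
have ln2_gt0 : 0 < ln 2 :> R by rewrite ln_gt0// ltr1n.
set h := entropy_rate P in ae_len mean_len.
have excess : t%:R^-1 * mean_length P U t - h @[t --> \oo] --> 0.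
  rewrite -(subrr h); apply: cvgB; last exact: cvg_cst.
  have /fine_cvg := mean_len; apply: cvg_trans; apply: near_eq_cvg; near=> t.
  by rewrite /= (expectation_code_length P U t).
have entropy_le (t : nat) : (0 < t)%N -> h <= t%:R^-1 * (word_entropy P t / ln 2).
  move=> t0; rewrite mulrC -mulrA -invfM ler_pdivlMr ?mulr_gt0 ?ltr0n//.
  by rewrite [_ * t%:R]mulrC mulrCA; exact: word_entropy_ge.
(* Since log Z_t <= 0 and H_t >= th, the divergence per letter lies between 0 and E|U|/t - h. *)
have div0 : t%:R^-1 * (mean_length P U t + log2 (kraft_sum U t)
    - word_entropy P t / ln 2) @[t --> \oo] --> 0.
  apply: (squeeze_cvgr _ (cvg_cst 0) excess).
  near=> t; have t0 : (0 < t)%N by near: t; exact: nbhs_infty_gt.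
  rewrite mulr_ge0 ?divergence_mu_ge0//=.
  have i0 : 0 <= t%:R^-1 :> R by rewrite invr_ge0.
  have := ler_wpM2l i0 (log2_kraft_sum_le0 U U_code t t0).
  by rewrite mulr0 mulrBr mulrDr; have := entropy_le t t0; lra.
(* Nonnegativity of the divergence bounds log Z_t / t below by h - E|U|/t. *)
have kraft0 : (t%:R^-1 * log2 (kraft_sum U t) : R) @[t --> \oo] --> 0.
  have excessN : - (t%:R^-1 * mean_length P U t - h) @[t --> \oo] --> 0.
    by rewrite -oppr0; apply: cvgN.
  apply: (squeeze_cvgr _ excessN (cvg_cst 0)).
  near=> t; have t0 : (0 < t)%N by near: t; exact: nbhs_infty_gt.
  have i0 : 0 <= t%:R^-1 :> R by rewrite invr_ge0.
  have := ler_wpM2l i0 (log2_kraft_sum_le0 U U_code t t0).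
  rewrite mulr0 => -> /=; rewrite andbT.
  have := mulr_ge0 i0 (divergence_mu_ge0 P U t).
  by rewrite mulrBr mulrDr; have := entropy_le t t0; lra.
split; last first.
  by apply: cvg_trans div0; apply: near_eq_cvg; near=> t; rewrite divergence_mu.
(* A countable family of tolerances, so that one almost sure event serves all of them. *)
pose e (k : nat) : R := k.+1%:R^-1.
have e0 k : 0 < e k by rewrite invr_gt0 ltr0n.
have lower : {ae P, forall x : seq_space a0, forall k, \forall t \near \oo,
    seq_prob P (mkseq x t) < expR (- ((h - e k) * ln 2 * t%:R))}.
  apply: ae_foralln => k; apply: ae_seq_prob_lt => //.
  by rewrite ltr_pM2r// ltrBlDr ltrDl.
have upper : {ae P, forall x : seq_space a0, forall k, \forall t \near \oo,
    2 ^- code_length U t x <= seq_prob P (mkseq x t) * expR (e k * ln 2 * t%:R)}.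
  apply: ae_foralln => k.
  apply: (ae_subprob_le P (fun t u => 2 ^- size (U t u))); first exact: mulr_gt0.
    by move=> t u; rewrite invr_ge0 exprn_ge0.
  by move=> t; exact: kraft_mcmillan.
apply: filterS3 ae_len lower upper => x len low up.
(* Replacing -log mu by the code length costs log Z_t / t, which tends to 0. *)
suff gap : t%:R^-1 * (- log2 (seq_prob P (mkseq x t)) - (code_length U t x)%:R)
    @[t --> \oo] --> 0.
  have : t%:R^-1 * (- log2 (seq_prob P (mkseq x t)) - (code_length U t x)%:R)
      - t%:R^-1 * log2 (kraft_sum U t) @[t --> \oo] --> 0.
    by rewrite -(subr0 0); apply: cvgB.
  apply: cvg_trans; apply: near_eq_cvg; near=> t.
  rewrite word_probE first_letters_mkseq (log2_mu (a0 := a0)) /code_length.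
  by ring.
apply/cvgr0Pnorm_le => d d0.
(* One tolerance covers |U|/t against h, the other covers the bounds on P. *)
pose k := Num.truncn (2 / d).
have kd : 2 * e k <= d.
  rewrite /e ler_pdivrMr ?ltr0n// mulrC -ler_pdivrMr//.
  exact: ltW (truncnS_gt _).
near=> t; have t0 : (0 < t)%N by near: t; exact: nbhs_infty_gt.
have t0' : 0 < t%:R :> R by rewrite ltr0n.
have len_t : `|h - (code_length U t x)%:R / t%:R| < e k.
  by near: t; move/cvgrPdist_lt: len; exact.
have low_t : seq_prob P (mkseq x t) < expR (- ((h - e k) * ln 2 * t%:R)).
  by near: t; exact: low.
have up_t : 2 ^- code_length U t x <= seq_prob P (mkseq x t) * expR (e k * ln 2 * t%:R).
  by near: t; exact: up.
have w0 : 0 < 2 ^- code_length U t x :> R by rewrite invr_gt0 exprn_gt0.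
(* The code weight is positive, so the upper bound excludes a null prefix and the logarithm is
   genuine. *)
have px0 : 0 < seq_prob P (mkseq x t).
  by have := lt_le_trans w0 up_t; rewrite pmulr_lgt0 ?expR_gt0.
pose l := t%:R^-1 * log2 (seq_prob P (mkseq x t)).
pose n := (code_length U t x)%:R / t%:R : R.
have lo : l < - (h - e k).
  rewrite /l mulrC ltr_pdivrMr// /log2 ltr_pdivrMr//.
  by rewrite -ltr_expR lnK ?posrE// mulrAC !mulNr.
have hi : - n <= l + e k.
  rewrite -lerBlDr /l [leRHS]mulrC ler_pdivlMr// mulrBl mulNr divfK ?gt_eqF//.
  rewrite -log2_code_weight lerBlDr /log2 ler_pdivrMr// mulrDl divfK ?gt_eqF//.
  rewrite mulrAC -[leRHS]expRK -ler_expR expRK.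
  by rewrite lnK ?posrE// expRD lnK ?posrE.
rewrite mulrBr mulrN -/l [_ * (code_length _ _ _)%:R]mulrC -/n.
move: len_t; rewrite -/n ltr_norml ler_norml.
by move: (e0 k); lra.
Unshelve. all: by end_near. Qed.
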